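(* Let $R$ be an integral domain, let $F,G\in R[x]$ be polynomials of degrees $m$ and $n$ respectively with $m>n>0$, and let $(P_1^{(1)},\ldots,P_{l_1}^{(1)},\ldots,P_1^{(t)},\ldots,P_{l_t}^{(t)})$ be a complete recursive polynomial remainder sequence for $F$ and $G$. Put $j_0=m$ and $j_k=\deg P_{l_k}^{(k)}$ for $k=1,\ldots,t$. Assume that the matrices $U^{(2)},\ldots,U^{(t)}$ occurring in the construction of the reduced nested subresultant matrices of $F$ and $G$ are nonsingular. Then, for $k=1,\ldots,t$ and $0\le j<j_{k-1}-1$ (with moreover $j<n$ when $k=1$), the numbers of rows and columns of the $(k,j)$-th reduced nested subresultant matrix $\hat N^{(k,j)}(F,G)$ are $$(m+n-2(k-1)-2j)+j\qquad\text{and}\qquad m+n-2(k-1)-2j,$$ respectively.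
   Context: Throughout, $R$ is an integral domain with quotient field $K$, and $|M|$ denotes the determinant of a square matrix $M$ (the determinant of a $0\times0$ matrix is $1$). **PRS.** For polynomials $F,G\in R[x]$ of degrees $m>n$, a sequence $(P_1,\ldots,P_l)$ of nonzero polynomials in $R[x]$ is a polynomial remainder sequence (PRS) for $F$ and $G$ if $P_1=F$, $P_2=G$, and $\alpha_iP_{i-2}=q_{i-1}P_{i-1}+\beta_iP_i$ for $i=3,\ldots,l$, with $\alpha_i,\beta_i\in R$, polynomials $q_{i-1}$, and $\deg P_{i-1}>\deg P_i$. **Recursive PRS.** A sequence $(P_1^{(1)},\ldots,P_{l_1}^{(1)},P_1^{(2)},\ldots,P_{l_2}^{(2)},\ldots,P_1^{(t)},\ldots,P_{l_t}^{(t)})$ of nonzero polynomials is a recursive PRS for $F$ and $G$ if: $P_1^{(1)}=F$, $P_2^{(1)}=G$; for $k=2,\ldots,t$, $P_1^{(k)}=P_{l_{k-1}}^{(k-1)}$ and $P_2^{(k)}=\frac{d}{dx}P_{l_{k-1}}^{(k-1)}$; and for every $k=1,\ldots,t$, $(P_1^{(k)},\ldots,P_{l_k}^{(k)})$ is a PRS for $P_1^{(k)}$ and $P_2^{(k)}$ with $P_{l_k}^{(k)}=\gamma_k\cdot\gcd(P_1^{(k)},P_2^{(k)})$ for some $\gamma_k\in R$. It is complete if $P_{l_t}^{(t)}$ is a constant. Put $j_0=m$ and $j_k=\deg P_{l_k}^{(k)}$. **Subresultant matrix.** Let $A=\sum_{i=0}^{p}a_ix^i$ and $B=\sum_{i=0}^{q}b_ix^i$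 be polynomials regarded as having nominal degrees $p>q\ge 0$ (leading coefficients may vanish), and let $0\le j\le q$. $N^{(j)}(A,B)$ is the matrix obtained by placing side by side $q-j$ successively down-shifted coefficient columns of $A$ followed by $p-j$ successively down-shifted coefficient columns of $B$, both groups starting at the top row: it has $p+q-j$ rows, its column $c$ ($1\le c\le q-j$) has entry $a_{p-(r-c)}$ in row $r$, and its column $q-j+c$ ($1\le c\le p-j$) has entry $b_{q-(r-c)}$ in row $r$, with entries of out-of-range index equal to $0$. The pair $F,G$ has nominal degrees $m,n$; if $S$ is a polynomial written with nominal degree $d$, then $\frac{d}{dx}S$ has nominal degree $d-1$. **Reduced nested subresultant matrix** $\hat N^{(k,j)}=\hat N^{(k,j)}(F,G)$ (entries in $K$), defined for $k=1$ and $0\le j\le n$, and for $2\le k\le t$ and $0\le j\le j_{k-1}-1$. For $k=1$, $\hat N^{(1,j)}=N^{(j)}(F,G)$. For $k>1$: let $\hat N_U^{(k-1,j_{k-1})}$ be $\hat N^{(k-1,j_{k-1})}$ with its bottom $j_{k-1}+1$ rows deleted, and $\hat N_L^{(k-1,j_{k-1})}$ the matrix of its bottom $j_{k-1}+1$ rows. For $\tau=j_{k-1},\ldots,0$ let $\hat N_\tau^{(k-1,j_{k-1})}$ be the square matrix with $\hat N_U^{(k-1,j_{k-1})}$ on top and the $(j_{k-1}-\tau+1)$-th row of $\hat N_L^{(k-1,j_{k-1})}$ as bottom row, and set $\hat A_\tau^{(k-1)}=|\hat N_\tau^{(k-1,j_{k-1})}|$, $\hat A^{(k-1)}(x)=\sum_{\tau=0}^{j_{k-1}}\hat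 A_\tau^{(k-1)}x^\tau$ (nominal degree $j_{k-1}$), and $$H=(H_{p,q})=N^{(j)}\Big(\hat A^{(k-1)}(x),\tfrac{d}{dx}\hat A^{(k-1)}(x)\Big),$$ a matrix with $I_{k,j}=(2j_{k-1}-2j-1)+j$ rows and $J_{k,j}=2j_{k-1}-2j-1$ columns. Write $\hat N_U^{(k-1,j_{k-1})}=(U^{(k)}\mid \boldsymbol v^{(k)})$ with $U^{(k)}$ square and $\boldsymbol v^{(k)}$ a column vector. Each entry $H_{p,q}$ is either a zero outside the shifted coefficient columns, in which case put $\boldsymbol b_{p,q}^{(k)}=\boldsymbol 0$ and $g_{p,q}^{(k)}=0$, or is of the form $c\,\hat A_\tau^{(k-1)}$ with $c=1$ (a coefficient of $\hat A^{(k-1)}$) or $c=\tau$ (a coefficient of $\frac{d}{dx}\hat A^{(k-1)}$), in which case $(\boldsymbol b_{p,q}^{(k)}\mid g_{p,q}^{(k)})$ is $c$ times the bottom row of $\hat N_\tau^{(k-1,j_{k-1})}$ ($\boldsymbol b_{p,q}^{(k)}$ a row vector, $g_{p,q}^{(k)}$ a scalar). Thus $$H_{p,q}=\begin{vmatrix}U^{(k)}&\boldsymbol v^{(k)}\\ \boldsymbol b_{p,q}^{(k)}&g_{p,q}^{(k)}\end{vmatrix}.$$ Assume $U^{(k)}$ is nonsingular. For $p=1,\ldots,I_{k,j}$ and $q=2,\ldots,J_{k,j}$ let $\boldsymbol x_{p,q}^{(k)}$ be the row vector over $K$ solving $\boldsymbol x_{p,q}^{(k)}U^{(k)}=\boldsymbol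 b_{p,1}^{(k)}-\boldsymbol b_{p,q}^{(k)}$, and put $h_{p,q}^{(k)}=g_{p,q}^{(k)}+\boldsymbol x_{p,q}^{(k)}\boldsymbol v^{(k)}$. Then $$\hat N^{(k,j)}(F,G)=\begin{pmatrix}U^{(k)}&\boldsymbol v^{(k)}&\boldsymbol v^{(k)}&\cdots&\boldsymbol v^{(k)}\\ \boldsymbol b_{1,1}^{(k)}&g_{1,1}^{(k)}&h_{1,2}^{(k)}&\cdots&h_{1,J_{k,j}}^{(k)}\\ \vdots&\vdots&\vdots&&\vdots\\ \boldsymbol b_{I_{k,j},1}^{(k)}&g_{I_{k,j},1}^{(k)}&h_{I_{k,j},2}^{(k)}&\cdots&h_{I_{k,j},J_{k,j}}^{(k)}\end{pmatrix}.$$ *)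

(* Defs.v *)
From HB Require Import structures.
From mathcomp Require Import all_boot all_order all_algebra.
From mathcomp Require Import zify.

Set Implicit Arguments.
Unset Strict Implicit.
Unset Printing Implicit Defensive.

Import Order.TTheory GRing.Theory Num.Theory.
Local Open Scope ring_scope.

(* Sequences are numbered from 1: only P 1, ..., P l matter.
   The entries alpha and beta are not required to be nonzero. *)
Definition is_prs (R : idomainType) (F G : {poly R}) (l : nat)
    (P : nat -> {poly R}) : Prop :=
  [/\ (1 < l)%N /\ (size G < size F)%N,
      P 1 = F /\ P 2 = G,
      forall i, (1 <= i <= l)%N -> P i != 0 &
      forall i, (3 <= i <= l)%N ->
        (size (P i) < size (P i.-1)%N)%N /\
        exists alpha beta (q : {poly R}),
          alpha *: P i.-2 = q * P i.-1 + beta *: P i].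

(* Over an integral domain, gcdp is a greatest common divisor up to nonzero
   constants, and %= is the corresponding association relation. *)
Definition is_scaled_gcd (R : idomainType) (S A B : {poly R}) : Prop :=
  exists (gamma : R) (g : {poly R}), g %= gcdp A B /\ S = gamma *: g.

(* P k i is the i-th polynomial of the k-th block, which has length l k. *)
Definition is_recursive_prs (R : idomainType) (F G : {poly R}) (t : nat)
    (l : nat -> nat) (P : nat -> nat -> {poly R}) : Prop :=
  [/\ (1 <= t)%N,
      P 1 1 = F /\ P 1 2 = G,
      forall k, (2 <= k <= t)%N ->
        P k 1 = P k.-1 (l k.-1) /\ P k 2 = (P k.-1 (l k.-1))^`() &
      forall k, (1 <= k <= t)%N ->
        is_prs (P k 1) (P k 2) (l k) (P k) /\
        is_scaled_gcd (P k (l k)) (P k 1) (P k 2)].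

Definition is_complete_recursive_prs (R : idomainType) (F G : {poly R})
    (t : nat) (l : nat -> nat) (P : nat -> nat -> {poly R}) : Prop :=
  is_recursive_prs F G t l P /\ (size (P t (l t)) <= 1)%N.

Definition block_deg (R : idomainType) (m : nat) (l : nat -> nat)
    (P : nat -> nat -> {poly R}) (k : nat) : nat :=
  if k is 0 then m else (size (P k (l k))).-1.

(* Entry in row r and column c (both numbered from 0) of the array made of
   q - j down-shifted columns (a p, ..., a 0) followed by p - j down-shifted
   columns (b q, ..., b 0).  The values lie in an arbitrary additive monoid V:
   besides scalars, V is used below as a type of row vectors. *)
Definition shift_entry (V : nmodType) (p q j : nat) (a b : nat -> V)
    (r c : nat) : V :=
  if (c < q - j)%N
  then if (c <= r <= c + p)%N then a (p - (r - c))%N else 0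
  else let c' := (c - (q - j))%N in
       if (c' <= r <= c' + q)%N then b (q - (r - c'))%N else 0.

(* N^(j)(A, B) for nominal degrees p and q. *)
Definition subres_mx (K : fieldType) (p q j : nat) (A B : {poly K}) :
    'M[K]_(p + q - j, (q - j) + (p - j)) :=
  \matrix_(r, c) shift_entry p q j (fun i => A`_i) (fun i => B`_i) r c.

(* One step of the construction.  N is the (k-1, j_(k-1))-th matrix and
   d = j_(k-1).  The type of N says that its top part, left after deletion of
   the bottom d + 1 rows, has one more column than it has rows. *)
Section Step.
Variables (K : fieldType) (u d : nat) (N : 'M[K]_(u + d.+1, u + 1)).

Definition upper_sq : 'M[K]_u := lsubmx (usubmx N).
Definition upper_col : 'cV[K]_u := rsubmx (usubmx N).

Definition bottom_row (tau : nat) : 'rV[K]_(u + 1) :=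
  row (inord (d - tau)) (dsubmx N).

Definition Nhat_tau (tau : nat) : 'M[K]_(u + 1) :=
  col_mx (usubmx N) (bottom_row tau).

Definition Ahat : {poly K} := \poly_(tau < d.+1) \det (Nhat_tau tau).

Definition Hmx (j : nat) : 'M[K]_(d + d.-1 - j, (d.-1 - j) + (d - j)) :=
  subres_mx d d.-1 j Ahat Ahat^`().

(* The row vector (b_(r,c) | g_(r,c)).  It depends on the position (r, c) in
   the pattern of N^(j), not only on the value of H at (r, c); the coefficient
   of x^i in the derivative of Ahat comes from tau = i + 1. *)
Definition bg_row (j r c : nat) : 'rV[K]_(u + 1) :=
  shift_entry d d.-1 j bottom_row (fun i => bottom_row i.+1 *+ i.+1) r c.

Definition b_row (j r c : nat) : 'rV[K]_u := lsubmx (bg_row j r c).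
Definition g_entry (j r c : nat) : K := rsubmx (bg_row j r c) 0 0.

Definition h_entry (j : nat) (x : nat -> nat -> 'rV[K]_u) (r c : nat) : K :=
  g_entry j r c + (x r c *m upper_col) 0 0.

Definition next_mx (j : nat) (x : nat -> nat -> 'rV[K]_u) :
    'M[K]_(u + (d + d.-1 - j), u + ((d.-1 - j) + (d - j))) :=
  block_mx
    upper_sq (\matrix_(i, c) upper_col i 0)
    (\matrix_(r, i) b_row j r 0 0 i)
    (\matrix_(r, c) if c == 0%N :> nat then g_entry j r 0
                    else h_entry j x r c).

Lemma Hmx_det (j : nat) r c : (j < d)%N ->
  Hmx j r c = \det (block_mx upper_sq upper_col
                      (b_row j r c) (g_entry j r c)%:M).
Proof.
move=> ltjd; have d0 : (0 < d)%N by apply: leq_ltn_trans ltjd.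
rewrite /upper_sq /upper_col /b_row /g_entry.
have -> : (rsubmx (bg_row j r c) 0 0)%:M = rsubmx (bg_row j r c).
  by apply/rowP=> i; rewrite !ord1 mxE eqxx mulr1n.
rewrite -[usubmx N in RHS]hsubmxK.
have blockE (w : 'rV[K]_(u + 1)) :
    block_mx (lsubmx (usubmx N)) (rsubmx (usubmx N)) (lsubmx w) (rsubmx w)
    = col_mx (usubmx N) w.
  by rewrite /block_mx !hsubmxK.
rewrite hsubmxK blockE.
have det0r : \det (col_mx (usubmx N) (0 : 'rV[K]_(u + 1))) = 0.
  rewrite (expand_det_row _ (rshift u ord0)) big1 // => i _.
  by rewrite col_mxEd mxE mul0r.
have detMn (w : 'rV[K]_(u + 1)) k :
    \det (col_mx (usubmx N) (w *+ k)) = \det (col_mx (usubmx N) w) *+ k.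
  rewrite !(expand_det_row _ (rshift u ord0)) -sumrMnl; apply: eq_bigr => i _.
  rewrite !col_mxEd -scaler_nat mxE -mulrA mulr_natl; congr (_ * _ *+ _).
  rewrite /cofactor; congr (_ * \det _); apply/matrixP=> a b; rewrite !mxE.
  case: splitP => [//|a' /= Ea]; have := ltn_ord a; have := ltn_ord a'.
  move: Ea; rewrite /bump /=; case: leqP => //= *; lia.
rewrite mxE /bg_row /shift_entry; do 2?[case: ifP => _] => //.
- by rewrite coef_poly ltnS leq_subr.
- rewrite coef_deriv coef_poly ltnS (leq_ltn_trans (leq_subr _ _)) ?prednK //.
Qed.
End Step.

(* reduced_nested m n F G jd k j M means that M is the (k, j)-th reduced nested
   subresultant matrix of F and G, given their nominal degrees m and n and the
   degrees jd 1, jd 2, etc.  Since U is invertible, the conditions on x determine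
   all the entries of next_mx N j x. *)
Inductive reduced_nested (K : fieldType) (m n : nat) (F G : {poly K})
    (jd : nat -> nat) :
    nat -> nat -> forall nrows ncols : nat, 'M[K]_(nrows, ncols) -> Prop :=
| ReducedNestedBase j :
    (j <= n)%N ->
    reduced_nested m n F G jd 1 j (subres_mx m n j F G)
| ReducedNestedStep k j u (N : 'M[K]_(u + (jd k).+1, u + 1))
    (x : nat -> nat -> 'rV[K]_u) :
    reduced_nested m n F G jd k (jd k) N ->
    (j < jd k)%N ->
    upper_sq N \in unitmx ->
    (forall r c, (r < jd k + (jd k).-1 - j)%N ->
       (0 < c < ((jd k).-1 - j) + (jd k - j))%N ->
       x r c *m upper_sq N = b_row N j r 0 - b_row N j r c) ->
    reduced_nested m n F G jd k.+1 j (next_mx N j x).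

(* Main.v *)
Require Import Defs.
From mathcomp Require Import all_boot all_order all_algebra.
From mathcomp Require Import zify.
Set Implicit Arguments.
Unset Strict Implicit.
Unset Printing Implicit Defensive.
Import Order.TTheory GRing.Theory Num.Theory.
Local Open Scope ring_scope.

(** The size formulas are a count that telescopes.  If the matrix at stage [k]
    and index [d], where [d] is the degree closing block [k], has [u + 1]
    columns, then the step to stage [k + 1] keeps [u] of them and adds the
    [(d - 1 - j) + (d - j)] columns of a subresultant matrix of a polynomial of
    nominal degree [d] and its derivative.  The total is
    [(u + 1) + 2 * d - 2 - 2 * j], so the quantity
    (number of columns) + 2 * (index) decreases by exactly 2 at each stage; it
    equals [m + n] at stage 1.  At every stage there are moreover [j] more rows
    than columns.  Both invariants follow by induction on the construction
    ([reduced_nested_dims]).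

    For existence, a step can be taken at [j < d] as soon as the previous matrix
    has the shape [(u + d.+1) x (u + 1)] and its upper-left square block is
    invertible.  The shape is a consequence of the same invariants, and the
    closing degrees admit it because the degree drops strictly from each block
    to the next ([block_deg_lt], [block_deg1_le]): a block has at least two terms
    of decreasing degree, and its first term is the polynomial that closes the
    previous block. *)

(** Positivity of the number of columns is part of the invariant because the
    next step singles out the last column of the upper block: this is where
    [n < m] is used at stage 1, and [j < d] later. *)
Lemma reduced_nested_dims (K : fieldType) (m n : nat) (F G : {poly K})
    (jd : nat -> nat) k j nrows ncols (M : 'M[K]_(nrows, ncols)) :
  (n < m)%N -> reduced_nested m n F G jd k j M ->
  [/\ (0 < k)%N, (0 < ncols)%N, nrows = (ncols + j)%N &
      (ncols + 2 * k.-1 + 2 * j = m + n)%N].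
Proof.
move=> ltnm; elim=> {k j nrows ncols M} [j lejn | k j u N x _ IH ltjd _ _].
  by split; lia.
by case: IH => k_gt0 _ _ ?; split; lia.
Qed.

(** The range of [j] reaches the extreme indices [n] (at stage 1) and
    [(jd k.-1).-1] (later), because the induction passes through index [jd k],
    which may take these values.  The vectors [x] of the construction are
    obtained by inverting the square block. *)
Lemma reduced_nested_exists (K : fieldType) (m n t : nat) (F G : {poly K})
    (jd : nat -> nat) :
  (n < m)%N -> (jd 1 <= n)%N ->
  (forall k, (2 <= k <= t)%N -> (jd k < jd k.-1)%N) ->
  (forall k, (2 <= k <= t)%N ->
     forall u (N : 'M[K]_(u + (jd k.-1).+1, u + 1)),
       reduced_nested m n F G jd k.-1 (jd k.-1) N -> upper_sq N \in unitmx) ->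
  forall k j : nat, (1 <= k <= t)%N ->
    (if k == 1 then j <= n else j < jd k.-1)%N ->
  exists nrows ncols (M : 'M[K]_(nrows, ncols)),
    reduced_nested m n F G jd k j M.
Proof.
move=> ltnm jd1 jd_lt unitU; elim=> [//|k IH] j kt.
case: k => [|k] /= in IH kt * => ltj.
  by exists _, _, (subres_mx m n j F G); constructor.
have [||nrows [ncols [N NP]]] := IH (jd k.+1); first by lia.
  by case: k => [|k] in IH kt ltj * => //=; apply: (jd_lt k.+2); lia.
have [_ cols_gt0 Er _] := reduced_nested_dims ltnm NP.
(* Name the dimensions so that the type of N displays the upper block. *)
have Ec : ncols = (ncols.-1 + 1)%N by lia.
have {}Er : nrows = (ncols.-1 + (jd k.+1).+1)%N by lia.
move: (ncols.-1) Er Ec => u Er Ec; subst nrows ncols.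
have Uu : upper_sq N \in unitmx by apply: (unitU k.+2).
pose x r c := (b_row N j r 0 - b_row N j r c) *m invmx (upper_sq N).
exists _, _, (next_mx N j x); apply: ReducedNestedStep => // r c _ _.
by rewrite mulmxKV.
Qed.

Lemma prs_last_size (R : idomainType) (F G : {poly R}) l P :
  is_prs F G l P -> P l != 0 /\ (size (P l) <= size G)%N.
Proof.
case=> -[l_gt1 _] [_ P2] Pneq0 Pstep; split; first by apply: Pneq0; lia.
suff le i : (i.+2 <= l)%N -> (size (P i.+2) <= size G)%N.
  by rewrite -(subnK l_gt1) addn2; apply: le; lia.
elim: i => [|i IH] lei; first by rewrite P2.
have [|lt_size _] := Pstep i.+3; first by lia.
by apply: leq_trans (ltnW lt_size) (IH _); lia.
Qed.

Lemma block_deg1_le (R : idomainType) (m n : nat) (F G : {poly R}) t l P :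
  size G = n.+1 -> is_recursive_prs F G t l P -> (block_deg m l P 1 <= n)%N.
Proof.
move=> sG [t_gt0 [_ P12] _ /(_ 1%N) [|/prs_last_size[_ le1] _]]; first by lia.
by move: le1; rewrite P12 sG /=; lia.
Qed.

(** The first two terms of a remainder sequence drop strictly in size, and the
    first term of block [k] is the polynomial closing block [k.-1].  The closing
    polynomials are nonzero, so comparing sizes compares degrees. *)
Lemma block_deg_lt (R : idomainType) (m : nat) (F G : {poly R}) t l P k :
  is_recursive_prs F G t l P -> (2 <= k <= t)%N ->
  (block_deg m l P k < block_deg m l P k.-1)%N.
Proof.
case=> _ _ start block kt.
have [Pk1 _] := start k kt.
have [|prs_k _] := block k; first by lia.
have [Pl_neq0 le_size] := prs_last_size prs_k.
have [[_ lt_size] _ _ _] := prs_k.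
case: k => [//|[//|k]] in kt Pk1 Pl_neq0 le_size lt_size prs_k *.
move: Pl_neq0 lt_size; rewrite Pk1 -size_poly_gt0 /= in le_size *; lia.
Qed.

Theorem proposition2 (R : idomainType) (m n : nat) (F G : {poly R})
    (t : nat) (l : nat -> nat) (P : nat -> nat -> {poly R})
    (K := {fraction R}) (FK := map_poly (@tofrac R) F : {poly K})
    (GK := map_poly (@tofrac R) G : {poly K})
    (jd := block_deg m l P) :
  size F = m.+1 -> size G = n.+1 -> (n < m)%N -> (0 < n)%N ->
  is_complete_recursive_prs F G t l P ->
  (forall k, (2 <= k <= t)%N ->
     forall u (N : 'M[K]_(u + (jd k.-1).+1, u + 1)),
       reduced_nested m n FK GK jd k.-1 (jd k.-1) N ->
       upper_sq N \in unitmx) ->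
  forall k j : nat, (1 <= k <= t)%N -> (j < jd k.-1 - 1)%N ->
    (k = 1%N -> (j < n)%N) ->
    (exists nrows ncols (M : 'M[K]_(nrows, ncols)),
       reduced_nested m n FK GK jd k j M) /\
    (forall nrows ncols (M : 'M[K]_(nrows, ncols)),
       reduced_nested m n FK GK jd k j M ->
       nrows%:Z = (m%:Z + n%:Z - 2 * (k%:Z - 1) - 2 * j%:Z) + j%:Z /\
       ncols%:Z = m%:Z + n%:Z - 2 * (k%:Z - 1) - 2 * j%:Z).
Proof.
move=> sF sG ltnm n_gt0 [rprs _] unitU k j kt ltj k1; split.
  apply: (reduced_nested_exists ltnm _ _ unitU kt).
  - exact: block_deg1_le sG rprs.
  - by move=> i it; apply: block_deg_lt rprs it.
  - by case: eqP => [/k1|_]; lia.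
move=> nrows ncols M /(reduced_nested_dims ltnm) [k_gt0 _ -> Ec].
by split; lia.
Qed.
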